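(* The graph $R_{15}$ is Class 0, i.e. $\pi(R_{15})=15$.
   Context: $R_{15}$ is the graph on vertices $v_1,\dots,v_{15}$ whose adjacency lists (neighbors of $v_1,v_2,\dots,v_{15}$ in order, given by indices) are: $v_1$: 2,4,5,6,12,13; $v_2$: 1,3,4,8,11,12,14; $v_3$: 2,4,6,7; $v_4$: 1,2,3,5,7,9,14; $v_5$: 1,4,6,8,11,15; $v_6$: 1,3,5,9,13,14; $v_7$: 3,4,11,15; $v_8$: 2,5,10,13,14,15; $v_9$: 4,6,10,11; $v_{10}$: 8,9,11; $v_{11}$: 2,5,7,9,10,12,15; $v_{12}$: 1,2,11,13; $v_{13}$: 1,6,8,12; $v_{14}$: 2,4,6,8; $v_{15}$: 5,7,8,11. A configuration on a connected graph $G$ is a function $C:V(G)\to\mathbb{N}$; a pebbling step from $u$ to a neighbor $v$ removes two pebbles from $u$ and adds one to $v$; $C$ is $r$-solvable if some sequence of pebbling steps places a pebble on $r$. $\pi(G,r)$ is the minimum $t$ such that every configuration with $t$ pebbles in total is $r$-solvable, $\pi(G)=\max_r\pi(G,r)$, and $G$ is Class 0 if $\pi(G)=|V(G)|$. *)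

(* Defs.v *)
From mathcomp Require Import all_boot.
From Stdlib Require Import Relation_Operators.

Set Implicit Arguments.
Unset Strict Implicit.
Unset Printing Implicit Defensive.

Record connected_graph := ConnectedGraph {
  vertex :> finType;
  adj : rel vertex;
  adj_sym : symmetric adj;
  adj_irrefl : irreflexive adj;
  adj_connected : forall x y, connect adj x y
}.

Section Pebbling.

Variable G : connected_graph.

Definition configuration := {ffun G -> nat}.

Definition pebbles (C : configuration) : nat := \sum_(v : G) C v.

(* A step from u to v. The guard matters: subtraction on nat is truncated.
   The two cases do not overlap, since u != v by irreflexivity. *)
Definition pebbling_step (C C' : configuration) : Prop :=
  exists u v : G,
    [/\ adj u v, 2 <= C u &
        C' = [ffun w => if w == u then C w - 2
                        else if w == v then C w + 1 else C w]].

(* The sequence of steps may be empty. *)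
Definition solvable (r : G) (C : configuration) : Prop :=
  exists2 C' : configuration,
    clos_refl_trans_1n configuration pebbling_step C C' & 1 <= C' r.

Definition all_solvable (r : G) (t : nat) : Prop :=
  forall C : configuration, pebbles C = t -> solvable r C.

(* The pebbling numbers are given by their graphs: "the least t such that ..."
   is the relation "t has the property and is least", so no default value is
   needed; such a t is unique. *)
Definition is_rooted_pebbling_number (r : G) (t : nat) : Prop :=
  all_solvable r t /\ (forall s, all_solvable r s -> t <= s).

Definition is_pebbling_number (n : nat) : Prop :=
  exists2 p : G -> nat,
    (forall r, is_rooted_pebbling_number r (p r)) & n = \max_(r : G) p r.

Definition class0 : Prop := is_pebbling_number #|G|.

End Pebbling.

(* The i-th entry lists the indices (from 1) of the neighbours of v_i. *)
Definition R15_lists : seq (seq nat) :=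
  [:: [:: 2; 4; 5; 6; 12; 13];
      [:: 1; 3; 4; 8; 11; 12; 14];
      [:: 2; 4; 6; 7];
      [:: 1; 2; 3; 5; 7; 9; 14];
      [:: 1; 4; 6; 8; 11; 15];
      [:: 1; 3; 5; 9; 13; 14];
      [:: 3; 4; 11; 15];
      [:: 2; 5; 10; 13; 14; 15];
      [:: 4; 6; 10; 11];
      [:: 8; 9; 11];
      [:: 2; 5; 7; 9; 10; 12; 15];
      [:: 1; 2; 11; 13];
      [:: 1; 6; 8; 12];
      [:: 2; 4; 6; 8];
      [:: 5; 7; 8; 11]].

(* The ordinal i : 'I_15 stands for v_(i+1). *)
Definition R15_adj : rel 'I_15 :=
  fun i j => j.+1 \in nth [::] R15_lists i.

Lemma R15_forall (P : pred nat) :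
  all P (iota 0 15) -> forall i : 'I_15, P i.
Proof. by move=> /allP h i; apply: h; rewrite mem_iota /= ltn_ord. Qed.

Lemma R15_sym : symmetric R15_adj.
Proof.
move=> i j; apply/eqP; move: j; apply: (R15_forall (P := fun j =>
  (j.+1 \in nth [::] R15_lists i) == (i.+1 \in nth [::] R15_lists j))).
move: i; apply: (R15_forall (P := fun i => all (fun j =>
  (j.+1 \in nth [::] R15_lists i) == (i.+1 \in nth [::] R15_lists j))
  (iota 0 15))).
by vm_compute.
Qed.

Lemma R15_irrefl : irreflexive R15_adj.
Proof.
move=> i; apply/negbTE; move: i.
apply: (R15_forall (P := fun i => i.+1 \notin nth [::] R15_lists i)).
by vm_compute.
Qed.

Lemma R15_connected (i j : 'I_15) : connect R15_adj i j.
Proof.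
suff from0 k : connect R15_adj ord0 k.
  by apply: (connect_trans (y := ord0)) (from0 j); rewrite (sym_connect_sym R15_sym).
have step x y : connect R15_adj ord0 x -> R15_adj x y -> connect R15_adj ord0 y.
  by move=> h /connect1; apply: connect_trans.
pose parent := nth 0 [:: 0; 0; 1; 0; 0; 0; 3; 1; 3; 7; 1; 0; 0; 1; 4].
have parentP : forall l : 'I_15, l != 0 :> nat ->
    (parent l < l) && (l.+1 \in nth [::] R15_lists (parent l)).
  move=> l; apply/implyP; move: l.
  apply: (R15_forall (P := fun l => (l != 0) ==>
    ((parent l < l) && (l.+1 \in nth [::] R15_lists (parent l))))).
  by vm_compute.
case: k => m; elim/ltn_ind: m => m IH lt_m.
have [m0|m_n0] := eqVneq m 0.
  by rewrite (_ : Ordinal lt_m = ord0) //; apply: val_inj.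
have /andP[lt_p adj_p] := parentP (Ordinal lt_m) m_n0.
exact: (step (Ordinal (ltn_trans lt_p lt_m))) (IH _ lt_p _) adj_p.
Qed.

Definition R15 : connected_graph :=
  ConnectedGraph R15_sym R15_irrefl R15_connected.

(* Main.v *)
Require Import Defs.
From mathcomp Require Import all_boot.
From mathcomp Require Import zify.
From Stdlib Require Import Relation_Operators.

Set Implicit Arguments.
Unset Strict Implicit.
Unset Printing Implicit Defensive.

(** If every vertex v of positive weight is adjacent to the root or to a vertex
    of weight at least 2 w(v), then pebbling steps towards the root do not
    decrease the total weight, so a configuration C with w(C) > sum w is
    solvable (Hurlbert's weight function lemma).  For every root of R15 except
    v10, finitely many such weights add up to at least k on each other vertex
    and to less than 15 k in total, so 15 pebbles violate one of the
    inequalities w(C) <= sum w.  For the root v10 the linear program has value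
    exactly 15: an unsolvable configuration of 15 pebbles lies on the optimal
    face, where v8, v9, v10, v11 are empty, v1 and v3 have six pebbles together
    and all other vertices have one.  Its seven lattice points are solvable. *)

(** * Weight functions and the lower bound on an arbitrary connected graph *)

Section Pebbling.

Variable G : connected_graph.
Implicit Types (C : configuration G) (r u v : G) (w : G -> nat).

Lemma solvable_root r C : 0 < C r -> solvable r C.
Proof. by exists C => //; apply: rt1n_refl. Qed.

Lemma solvable_step r C C' :
  pebbling_step C C' -> solvable r C' -> solvable r C.
Proof. by move=> st [D CD Dr]; exists D => //; apply: rt1n_trans st CD. Qed.

Definition move u v C : configuration G :=
  [ffun x => if x == u then C x - 2 else if x == v then C x + 1 else C x].

Lemma move_step u v C : adj u v -> 1 < C u -> pebbling_step C (move u v C).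
Proof. by exists u, v. Qed.

(** The balance is additive because subtraction on [nat] is truncated. With [w] constantly 1 it says
    that a step loses one pebble; if [2 * w u <= w v], it says that the weight does not drop. *)
Lemma sum_move w u v C : adj u v -> 1 < C u ->
  \sum_x w x * move u v C x + 2 * w u = \sum_x w x * C x + w v.
Proof.
move=> uv Cu; have vu : v != u by apply: contraTneq uv => ->; rewrite adj_irrefl.
have splitE (F : G -> nat) :
    \sum_x F x = F u + (F v + \sum_(x | (x != u) && (x != v)) F x).
  by rewrite (bigD1 u) //= (bigD1 v).
rewrite !splitE !ffunE eqxx (negbTE vu) eqxx.
under eq_bigr => x /andP[xu xv] do rewrite ffunE (negbTE xu) (negbTE xv).
by nia.
Qed.

Definition weight_function r w : Prop :=
  forall v, 0 < w v -> adj v r \/ exists2 p, adj v p & 2 * w v <= w p.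

(** Induction on the number of pebbles. If no vertex of positive weight held two pebbles,
    [w v * C v <= w v] would hold everywhere, against the hypothesis. A step from such a vertex
    either reaches the root or keeps the strict inequality with one pebble fewer. *)
Lemma weight_solvable r w C : weight_function r w ->
  \sum_v w v < \sum_v w v * C v -> solvable r C.
Proof.
move=> wP; have [n] := ubnP (\sum_v 1 * C v); elim: n C => // n IH C Cn wC.
have /existsP[v /andP[wv Cv]] : [exists v, (0 < w v) && (1 < C v)].
  apply: contraLR wC; rewrite negb_exists -leqNgt => /forallP small.
  apply: leq_sum => v _; have := small v; nia.
have [vr | [p vp wp]] := wP v wv.
  apply: solvable_step (move_step vr Cv) (solvable_root _).
  have rv : r != v by apply: contraTneq vr => ->; rewrite adj_irrefl.
  by rewrite ffunE eqxx (negbTE rv) addn1.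
apply: solvable_step (move_step vp Cv) (IH _ _ _).
  by have := sum_move (fun=> 1) vp Cv; lia.
by have := sum_move w vp Cv; lia.
Qed.

(** One pebble on each of [s] vertices other than the root admits no step, and there are enough such
    vertices when [s < #|G|]. *)
Lemma all_solvable_geq r s : all_solvable r s -> #|G| <= s.
Proof.
move=> sol; rewrite leqNgt; apply/negP => sG.
pose A := take s (enum (predC1 r)).
have szA : size A = s.
  by rewrite size_takel // -cardE cardC1; lia.
pose C : configuration G := [ffun v => nat_of_bool (v \in A)].
have CA : pebbles C = s.
  have uA : uniq A by rewrite take_uniq ?enum_uniq.
  rewrite -szA -(card_uniqP uA) -sum1_card [RHS]big_mkcond /=.
  by apply: eq_bigr => v _; rewrite ffunE; case: (v \in A).
have [C' CC' C'r] := sol _ CA; case: CC' C'r => [|D E [u [v [_ Cu _]]] _ _].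
  rewrite ffunE lt0b => /mem_take; by rewrite mem_enum inE eqxx.
by move: Cu; rewrite ffunE; case: (_ \in _).
Qed.

Lemma all_solvable_class0 : (forall r, all_solvable r #|G|) -> class0 G.
Proof.
move=> sol; exists (fun=> #|G|) => [r|]; first by split=> // s /all_solvable_geq.
apply/eqP; rewrite eqn_leq andbC; apply/andP; split; first exact/bigmax_leqP.
(* An empty maximum is 0, so a vertex is required to attain [#|G|], unless [#|G|] is itself 0. *)
have [-> // | /card_gt0P[r _]] := posnP #|G|.
exact: (leq_bigmax (F := fun=> #|G|) r).
Qed.

End Pebbling.

(** * Certificates checked by computation, for the roots other than v10 *)

Definition is_weight (r : nat) (w : seq nat) : bool :=
  (size w == 15) && all (fun v =>
    [|| nth 0 w v == 0, r.+1 \in nth [::] R15_lists v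
      | has (fun p => (p.+1 \in nth [::] R15_lists v)
                      && (2 * nth 0 w v <= nth 0 w p)) (iota 0 15)])
    (iota 0 15).

Lemma is_weightP (r : R15) w : is_weight r w ->
  weight_function r (fun v : R15 => nth 0 w v).
Proof.
case/andP=> _ /R15_forall wP v wv; have /or3P[/eqP w0 | vr | /hasP[p]] := wP v.
- by rewrite w0 in wv.
- by left.
rewrite mem_iota /= => p15 /andP[vp wp]; right.
by exists (Ordinal p15).
Qed.

Lemma R15_weight_solvable (r : R15) (C : configuration R15) w : is_weight r w ->
  sumn w < \sum_(v < 15) nth 0 w v * C v -> solvable r C.
Proof.
move=> wP wC; apply: (weight_solvable (is_weightP wP)).
case/andP: wP => /eqP sz _.
by move: wC; rewrite sumnE (big_nth 0) sz big_mkord.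
Qed.

(** A dual solution of the linear program with denominators cleared: divided by [k], the weights add
    up to at least 1 on each vertex other than the root and to less than 15 in total. *)
Definition covering (r k : nat) (ws : seq (seq nat)) : bool :=
  [&& all (is_weight r) ws,
      all (fun v => (v != r) ==> (k <= sumn [seq nth 0 w v | w <- ws]))
        (iota 0 15)
    & sumn (map sumn ws) < 15 * k].

Lemma covering_all_solvable (r : R15) k ws :
  covering r k ws -> all_solvable r 15.
Proof.
case/and3P=> /allP wsP /R15_forall wsk wsum C C15.
have [Cr|] := posnP (C r); last exact: solvable_root.
have [/hasP[w /wsP wP wC]|] :=
  boolP (has (fun w => sumn w < \sum_(v < 15) nth 0 w v * C v) ws).
  exact: R15_weight_solvable wP wC.
rewrite -all_predC => /allP le_ws; exfalso.
suff: 15 * k <= sumn (map sumn ws) by lia.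
rewrite sumnE big_map.
(* After exchanging the sums, each pebble contributes the total weight of its vertex, which is at
   least [k] off the root; the root itself is empty. *)
rewrite (leq_trans (n := \sum_(w <- ws) \sum_(v < 15) nth 0 w v * C v)) //.
  rewrite exchange_big /= -{1}C15 /pebbles big_distrl leq_sum //= => v _.
  rewrite -big_distrl /= mulnC.
  have [-> | vr] := eqVneq v r; first by rewrite Cr !muln0.
  have := wsk v; rewrite sumnE big_map (_ : (v != r :> nat)) //=.
  by move=> le_k; rewrite leq_mul2r le_k orbT.
rewrite big_seq [leqRHS]big_seq leq_sum // => w /le_ws /=.
by rewrite -leqNgt.
Qed.

(* Entry r is a pair (k, ws) covering the root v_(r+1); the entry of index 9,
   for v10, is a dummy. *)
Definition R15_certificates : seq (nat * seq (seq nat)) :=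
  [:: (4,
    [:: [:: 0; 0; 0; 0; 0; 0; 0; 0; 0; 1; 2; 4; 0; 0; 0];
        [:: 0; 4; 2; 0; 0; 0; 1; 2; 1; 1; 2; 0; 0; 2; 1];
        [:: 0; 0; 0; 0; 4; 0; 1; 0; 0; 0; 0; 0; 0; 0; 2];
        [:: 0; 0; 0; 0; 0; 4; 0; 0; 2; 0; 0; 0; 0; 0; 0];
        [:: 0; 0; 0; 0; 0; 0; 0; 2; 0; 1; 0; 0; 4; 0; 0];
        [:: 0; 0; 2; 4; 0; 0; 2; 1; 2; 1; 1; 0; 0; 2; 1]]);
  (6,
    [:: [:: 0; 0; 0; 4; 2; 4; 2; 4; 2; 2; 0; 0; 2; 8; 2];
        [:: 0; 0; 0; 0; 0; 0; 0; 0; 0; 0; 0; 6; 3; 0; 0];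
        [:: 0; 0; 2; 0; 0; 0; 0; 0; 0; 0; 0; 0; 0; 0; 0];
        [:: 1; 0; 4; 2; 0; 0; 0; 0; 0; 0; 0; 0; 0; 0; 0];
        [:: 5; 0; 0; 0; 0; 0; 0; 0; 0; 0; 0; 0; 0; 0; 0];
        [:: 0; 0; 0; 0; 4; 2; 4; 0; 4; 4; 8; 0; 1; 0; 4];
        [:: 0; 0; 0; 0; 0; 0; 0; 2; 0; 0; 0; 0; 0; 1; 0]]);
  (8,
    [:: [:: 4; 0; 0; 8; 4; 0; 0; 2; 4; 2; 2; 2; 2; 4; 2];
        [:: 0; 0; 0; 0; 0; 0; 8; 0; 0; 2; 4; 2; 1; 0; 4];
        [:: 4; 0; 0; 0; 4; 8; 0; 2; 4; 2; 2; 2; 4; 4; 2];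
        [:: 0; 8; 0; 0; 0; 0; 0; 4; 0; 2; 0; 4; 2; 0; 2]]);
  (16,
    [:: [:: 20; 0; 0; 0; 0; 0; 0; 0; 0; 0; 0; 0; 10; 0; 0];
        [:: 0; 8; 16; 0; 0; 0; 0; 0; 0; 0; 0; 4; 0; 0; 0];
        [:: 0; 0; 0; 0; 0; 8; 0; 0; 4; 0; 0; 0; 0; 16; 0];
        [:: 0; 8; 0; 0; 0; 0; 0; 0; 0; 0; 0; 4; 0; 0; 0];
        [:: 0; 0; 0; 0; 16; 8; 0; 8; 0; 4; 8; 4; 4; 0; 8];
        [:: 0; 0; 0; 0; 0; 1; 16; 4; 0; 4; 8; 4; 2; 0; 8];
        [:: 0; 0; 0; 0; 0; 0; 0; 4; 16; 8; 0; 0; 0; 0; 0]]);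
  (4,
    [:: [:: 2; 2; 2; 4; 0; 0; 2; 0; 2; 1; 0; 1; 1; 2; 0];
        [:: 2; 1; 2; 0; 0; 4; 1; 0; 2; 1; 0; 1; 2; 2; 0];
        [:: 0; 0; 0; 0; 0; 0; 0; 0; 0; 0; 4; 2; 1; 0; 0];
        [:: 0; 0; 0; 0; 0; 0; 2; 0; 0; 0; 0; 0; 0; 0; 4];
        [:: 0; 1; 0; 2; 0; 0; 0; 0; 0; 0; 0; 0; 0; 0; 0];
        [:: 0; 0; 0; 0; 0; 0; 0; 4; 0; 2; 0; 0; 0; 0; 0]]);
  (4,
    [:: [:: 0; 0; 4; 0; 0; 0; 2; 0; 0; 0; 0; 0; 0; 0; 1];
        [:: 4; 0; 0; 0; 0; 0; 0; 0; 0; 0; 0; 2; 0; 0; 0];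
        [:: 0; 2; 0; 0; 0; 0; 0; 0; 0; 0; 0; 0; 0; 4; 0];
        [:: 0; 1; 0; 2; 0; 0; 1; 1; 4; 2; 2; 1; 0; 0; 1];
        [:: 0; 1; 0; 2; 4; 0; 1; 2; 0; 1; 2; 1; 0; 0; 2];
        [:: 0; 0; 0; 0; 0; 0; 0; 2; 0; 1; 0; 0; 4; 0; 0]]);
  (8,
    [:: [:: 4; 0; 0; 8; 0; 0; 0; 0; 4; 2; 0; 2; 2; 4; 0];
        [:: 2; 2; 0; 0; 4; 2; 0; 4; 1; 2; 0; 1; 2; 2; 8];
        [:: 2; 4; 0; 0; 4; 2; 0; 2; 4; 4; 8; 4; 2; 2; 0];
        [:: 0; 4; 8; 0; 0; 4; 0; 2; 2; 1; 0; 2; 2; 0; 0]]);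
  (4,
    [:: [:: 0; 0; 1; 0; 0; 2; 0; 0; 0; 0; 0; 0; 0; 4; 0];
        [:: 2; 0; 1; 2; 4; 2; 1; 0; 1; 0; 2; 1; 0; 0; 0];
        [:: 0; 0; 0; 0; 0; 0; 2; 0; 0; 0; 0; 0; 0; 0; 4];
        [:: 0; 0; 0; 0; 0; 0; 0; 0; 2; 4; 0; 0; 0; 0; 0];
        [:: 2; 4; 2; 2; 0; 1; 1; 0; 1; 0; 2; 2; 0; 0; 0];
        [:: 0; 0; 0; 0; 0; 0; 0; 0; 0; 0; 1; 2; 4; 0; 0]]);
  (4,
    [:: [:: 0; 0; 1; 0; 0; 0; 2; 0; 0; 0; 4; 2; 1; 0; 2];
        [:: 2; 1; 2; 0; 2; 4; 1; 1; 0; 0; 0; 1; 2; 2; 1];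
        [:: 2; 2; 2; 4; 2; 0; 2; 1; 0; 0; 0; 1; 1; 2; 1];
        [:: 0; 1; 0; 0; 0; 0; 0; 2; 0; 4; 0; 0; 0; 0; 0]]);
  (0, [::]);
  (8,
    [:: [:: 2; 0; 4; 4; 0; 2; 8; 1; 0; 0; 0; 0; 1; 2; 0];
        [:: 0; 0; 0; 0; 0; 0; 0; 4; 0; 8; 0; 0; 0; 2; 0];
        [:: 2; 0; 2; 4; 0; 4; 0; 1; 8; 0; 0; 0; 2; 2; 0];
        [:: 4; 4; 2; 2; 0; 2; 0; 2; 0; 0; 0; 8; 4; 2; 0];
        [:: 0; 0; 0; 0; 8; 0; 0; 0; 0; 0; 0; 0; 0; 0; 4];
        [:: 0; 0; 0; 0; 0; 0; 0; 2; 0; 0; 0; 0; 1; 0; 4];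
        [:: 0; 4; 0; 2; 0; 0; 0; 0; 1; 0; 0; 0; 0; 0; 0]]);
  (12,
    [:: [:: 0; 0; 4; 4; 8; 4; 8; 4; 8; 8; 16; 0; 0; 2; 8];
        [:: 0; 12; 6; 0; 0; 0; 3; 0; 0; 0; 0; 0; 0; 6; 0];
        [:: 0; 0; 4; 2; 4; 8; 2; 8; 4; 4; 0; 0; 16; 4; 4];
        [:: 12; 0; 0; 6; 0; 0; 0; 0; 0; 0; 0; 0; 0; 0; 0]]);
  (16,
    [:: [:: 16; 0; 4; 8; 0; 0; 4; 0; 4; 2; 2; 0; 0; 0; 2];
        [:: 0; 10; 5; 5; 10; 0; 5; 20; 5; 10; 5; 0; 0; 10; 10];
        [:: 0; 4; 8; 4; 8; 16; 4; 0; 8; 4; 4; 0; 0; 8; 4];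
        [:: 0; 2; 0; 0; 0; 0; 0; 0; 0; 0; 0; 4; 0; 0; 0];
        [:: 0; 0; 0; 0; 0; 0; 3; 0; 0; 0; 6; 12; 0; 0; 0]]);
  (4,
    [:: [:: 0; 0; 0; 0; 0; 0; 1; 4; 1; 2; 1; 1; 2; 0; 2];
        [:: 2; 0; 2; 4; 2; 0; 2; 0; 2; 1; 1; 1; 1; 0; 1];
        [:: 2; 4; 2; 0; 1; 0; 1; 2; 1; 1; 2; 2; 1; 0; 1];
        [:: 0; 0; 0; 0; 2; 4; 0; 0; 0; 0; 0; 0; 0; 0; 0]]);
  (8,
    [:: [:: 2; 4; 2; 2; 4; 2; 0; 0; 4; 4; 8; 4; 2; 2; 0];
        [:: 2; 0; 0; 0; 4; 2; 0; 0; 1; 0; 0; 1; 1; 1; 0];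
        [:: 2; 2; 4; 4; 0; 2; 8; 0; 2; 1; 0; 1; 1; 2; 0];
        [:: 2; 4; 2; 2; 0; 2; 0; 8; 2; 4; 0; 2; 4; 4; 0]])].

Lemma R15_covering (r : R15) : r != 9 :> nat -> all_solvable r 15.
Proof.
have : all (fun r => (r != 9) ==>
  covering r (nth (0, [::]) R15_certificates r).1
             (nth (0, [::]) R15_certificates r).2) (iota 0 15) by vm_compute.
by move/R15_forall/(_ r)/implyP=> + r9 => /(_ r9); apply: covering_all_solvable.
Qed.

(** * The root v10: explicit move sequences and the optimal face *)

Definition list_configuration (s : seq nat) : configuration R15 :=
  [ffun v : 'I_15 => nth 0 s v].

Fixpoint run (r : nat) (moves : seq (nat * nat)) (s : seq nat) : bool :=
  if moves is (u, v) :: moves' then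
    [&& u < 15, v < 15, v.+1 \in nth [::] R15_lists u, 1 < nth 0 s u
      & run r moves'
          (set_nth 0 (set_nth 0 s u (nth 0 s u - 2)) v (nth 0 s v + 1))]
  else 0 < nth 0 s r.

Lemma run_solvable (r : R15) moves s :
  run r moves s -> solvable r (list_configuration s).
Proof.
elim: moves s => [|[u v] moves IH] s /=.
  by move=> sr; apply: solvable_root; rewrite ffunE.
case/and5P=> u15 v15 uv su /IH sol.
have uv' : adj (Ordinal u15 : R15) (Ordinal v15) by [].
apply: solvable_step (move_step uv' _) _; first by rewrite ffunE.
(* [run] lets the update at [v] override the one at [u], whereas [move] tests [u] first; they agree
   because [u] and [v] differ. *)
have vu : (v == u) = false.
  apply: contraTF uv' => /eqP vu.
  by rewrite (_ : Ordinal v15 = Ordinal u15) ?adj_irrefl //; apply: val_inj.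
congr (solvable r _): sol; apply/ffunP => x.
rewrite !ffunE !nth_set_nth /= nth_set_nth /= -!val_eqE /=.
have [->|_] := eqVneq (x : nat) v; first by rewrite vu.
by have [->|] := eqVneq (x : nat) u.
Qed.

Definition v10_weights : seq (seq nat) :=
  [:: [:: 1; 2; 1; 0; 0; 0; 1; 4; 0; 0; 0; 1; 2; 2; 2];
      [:: 2; 2; 2; 4; 2; 4; 0; 0; 8; 0; 0; 1; 2; 0; 0];
      [:: 1; 2; 1; 0; 2; 1; 1; 4; 0; 0; 0; 1; 0; 2; 2];
      [:: 1; 2; 1; 1; 2; 0; 1; 4; 0; 0; 0; 0; 0; 0; 2];
      [:: 2; 0; 2; 4; 2; 4; 2; 0; 8; 0; 0; 1; 2; 2; 0];
      [:: 2; 0; 2; 2; 4; 0; 4; 0; 0; 0; 8; 4; 2; 1; 0];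
      [:: 1; 0; 1; 0; 0; 0; 2; 0; 0; 0; 4; 2; 1; 0; 2];
      [:: 1; 2; 1; 0; 2; 1; 2; 0; 0; 0; 4; 2; 0; 1; 2];
      [:: 2; 0; 2; 4; 2; 4; 0; 0; 8; 0; 0; 1; 2; 2; 1];
      [:: 1; 2; 1; 0; 0; 0; 2; 0; 0; 0; 4; 2; 1; 1; 2]].

Lemma v10_all_solvable (r : R15) : r = 9 :> nat -> all_solvable r 15.
Proof.
move=> r9 C C15.
have [Cr|] := posnP (C r); last exact: solvable_root.
have wsP : all (is_weight r) v10_weights by rewrite r9; vm_compute.
have [/hasP[w w_ws wC]|] :=
  boolP (has (fun w => sumn w < \sum_(v < 15) nth 0 w v * C v) v10_weights).
  exact: R15_weight_solvable (allP wsP w w_ws) wC.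
(* Indexing by naturals lets the sums over ['I_15] unfold into explicit linear expressions for
   [lia]. *)
pose c k := C (inord k : 'I_15).
have cE (v : 'I_15) : C v = c v by rewrite /c inord_val.
have sumE w : \sum_(v < 15) nth 0 w v * C v =
    sumn [seq nth 0 w v * c v | v <- iota 0 15].
  rewrite sumnE big_map -[iota 0 15]/(index_iota 0 15) big_mkord.
  by apply: eq_bigr => v _; rewrite cE.
have c15 : sumn [seq c v | v <- iota 0 15] = 15.
  rewrite -[RHS]C15 /pebbles sumnE big_map -[iota 0 15]/(index_iota 0 15).
  rewrite big_mkord.
  by apply: eq_bigr => v _; rewrite cE.
have c9 : c 9 = 0 by move: Cr; rewrite cE r9.
have CE : C = list_configuration [seq c v | v <- iota 0 15].
  by apply/ffunP => v; rewrite ffunE (nth_map 0) ?size_iota // nth_iota // cE.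
rewrite -all_predC /= !sumE CE; move: c15; rewrite /= c9 !addn0.
move: (c 0) (c 1) (c 2) (c 3) (c 4) (c 5) (c 6) (c 7) (c 8) (c 10) (c 11).
move: (c 12) (c 13) (c 14).
move=> c12 c13 c14 c0 c1 c2 c3 c4 c5 c6 c7 c8 c10 c11 c15 le_ws.
(* The ten weight inequalities and the total 15 force every count except [c0] and [c2], whose sum is
   6. Indices start at 0, so [c7] belongs to v8. *)
have [c7E c8E c10E] : [/\ c7 = 0, c8 = 0 & c10 = 0] by split; lia.
have [c1E c3E c4E c5E] : [/\ c1 = 1, c3 = 1, c4 = 1 & c5 = 1] by split; lia.
have [c6E c11E c12E] : [/\ c6 = 1, c11 = 1 & c12 = 1] by split; lia.
have [c13E c14E] : c13 = 1 /\ c14 = 1 by lia.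
have c2E : c2 = 6 - c0 by lia.
have : c0 \in iota 0 7 by rewrite mem_iota; lia.
rewrite {}c1E {}c2E {}c3E {}c4E {}c5E {}c6E {}c7E {}c8E {}c10E {}c11E {}c12E
  {}c13E {}c14E => c0_le6; clear -r9 c0_le6.
(* Two pebbles must reach v8, the neighbour of v10 with index 7. Each intermediate vertex already
   holds one pebble, so one more lets it pass a pebble on. The two routes start both at v1, one each
   at v1 and v3, or both at v3. *)
pose moves := if 3 < c0 then [:: (0, 4); (4, 7); (0, 1); (1, 7); (7, 9)]
  else if 1 < c0 then [:: (0, 4); (4, 7); (2, 1); (1, 7); (7, 9)]
  else [:: (2, 1); (1, 7); (2, 5); (5, 13); (13, 7); (7, 9)].
apply: (run_solvable (moves := moves)); rewrite r9 /moves => {moves r9}.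
by apply/allP: c0 c0_le6; vm_compute.
Qed.

Theorem theorem3p7 : class0 R15 /\ is_pebbling_number R15 15.
Proof.
have R15_class0 : class0 R15.
  apply: all_solvable_class0 => r; rewrite (card_ord 15).
  have [/v10_all_solvable | /R15_covering] := eqVneq (r : nat) 9; exact.
by split=> //; rewrite -(card_ord 15).
Qed.
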